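(* For every propositional formula $A$, $\mathbf{DPL}\vdash A$ (that is, $A\in\mathbf{DPL}$) if and only if $\mathbf{D}\vdash A^{\mathcal V}$.
   Context: Propositional formulas are built from propositional variables and $\bot$ using $\land,\lor,\to$; modal formulas additionally use $\Box$; $\lnot A$ is $A\to\bot$. Visser's Gödel translation $(\cdot)^{\mathcal V}$ from propositional to modal formulas: $p^{\mathcal V}=p\land\Box p$ for variables $p$; $\bot^{\mathcal V}=\bot$; $(A\land B)^{\mathcal V}=A^{\mathcal V}\land B^{\mathcal V}$; $(A\lor B)^{\mathcal V}=A^{\mathcal V}\lor B^{\mathcal V}$; $(A\to B)^{\mathcal V}=\Box(A^{\mathcal V}\to B^{\mathcal V})$. $\mathbf{GL}$ is the smallest normal modal logic containing all $\Box(\Box A\to A)\to\Box A$. $\mathbf D$ (Japaridze's logic) is the smallest set of modal formulas that contains all theorems of $\mathbf{GL}$, all instances of $\Box(\Box A\lor\Box B)\to\Box A\lor\Box B$, and $\lnot\Box\bot$, and is closed under modus ponens (but not necessarily under necessitation). $\mathbf D\vdash A$ means $A\in\mathbf D$. $\mathbf{DPL}$ is the set of propositional formulas $A$ such that the sequent $\Rightarrow^{3}A$ (empty antecedent) is derivable in the calculus $\mathsf{G}_{\mathbf{DPL}}$, defined as follows. A sequent $\Gamma\Rightarrow^{\ell}\Delta$ of level $\ell\in\{1,2,3\}$ consists of two sets $\Gamma,\Delta$ of propositional formulas; commas denote union of sets and $A,\Gamma$ means $\{A\}\cup\Gamma$ (so contraction is built in). Rules are written ''premises / conclusion''; $\Gamma,\Delta,\Sigma$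 are arbitrary sets of formulas and $A,B$ arbitrary formulas. For each $\ell\in\{1,2,3\}$: - axioms $p\Rightarrow^{\ell}p$ ($p$ a propositional variable) and $\bot\Rightarrow^{\ell}$ (empty succedent); - weakening: $\Gamma\Rightarrow^{\ell}\Delta$ / $A,\Gamma\Rightarrow^{\ell}\Delta$, and $\Gamma\Rightarrow^{\ell}\Delta$ / $\Gamma\Rightarrow^{\ell}\Delta,A$; - $A,B,\Gamma\Rightarrow^{\ell}\Delta$ / $A\land B,\Gamma\Rightarrow^{\ell}\Delta$; - $\Gamma\Rightarrow^{\ell}\Delta,A$ and $\Gamma\Rightarrow^{\ell}\Delta,B$ / $\Gamma\Rightarrow^{\ell}\Delta,A\land B$; - $A,\Gamma\Rightarrow^{\ell}\Delta$ and $B,\Gamma\Rightarrow^{\ell}\Delta$ / $A\lor B,\Gamma\Rightarrow^{\ell}\Delta$; - $\Gamma\Rightarrow^{\ell}\Delta,A,B$ / $\Gamma\Rightarrow^{\ell}\Delta,A\lor B$; together with - lift from level 1 to 2: $\Gamma\Rightarrow^{1}\Delta$ / $\Gamma\Rightarrow^{2}\Delta$; - at level 2 only: $\Gamma\Rightarrow^{2}\Delta,A$ and $B,\Gamma\Rightarrow^{2}\Delta$ / $A\to B,\Gamma\Rightarrow^{2}\Delta$; - at level 1 only, for every $k\ge 0$ and formulas $C_0,\dots,C_{k-1},D_0,\dots,D_{k-1}$, the rule with the $2^k$ premises $\Delta_i,\Sigma,A\to B,A\Rightarrow^{1}B,\Gamma_i$ ($0\le i<2^k$) and conclusion $\Sigma,\{C_j\to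 D_j:0\le j<k\}\Rightarrow^{1}A\to B$, where $\Delta_i=\{D_j:\text{the }j\text{-th binary digit of } i \text{ is }1\}$ and $\Gamma_i=\{C_j:\text{the }j\text{-th binary digit of } i\text{ is }0\}$, $0\le j<k$ (digit $j$ has weight $2^j$); - lift from level 2 to 3: $\{A_i\to B_i:0\le i<n\},\Phi\Rightarrow^{2}\{C_j\to D_j:0\le j<m\}$ / $\{A_i\to B_i:0\le i<n\},\Phi\Rightarrow^{3}\{C_j\to D_j:0\le j<m\}$, for $n,m\ge0$, arbitrary formulas $A_i,B_i,C_j,D_j$, and $\Phi$ a set of propositional variables. There is no cut rule. *)

(* Defs.v *)
From mathcomp Require Import all_boot.
From mathcomp Require Import classical_sets.

Set Implicit Arguments.
Unset Strict Implicit.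
Unset Printing Implicit Defensive.

Local Open Scope classical_set_scope.

Inductive form : Type :=
| Var (p : nat)
| Bot
| And (A B : form)
| Or (A B : form)
| Imp (A B : form).

Inductive mform : Type :=
| MVar (p : nat)
| MBot
| MAnd (A B : mform)
| MOr (A B : mform)
| MImp (A B : mform)
| MBox (A : mform).

Definition MNot (A : mform) : mform := MImp A MBot.

Fixpoint visser (A : form) : mform :=
  match A with
  | Var p => MAnd (MVar p) (MBox (MVar p))
  | Bot => MBot
  | And A B => MAnd (visser A) (visser B)
  | Or A B => MOr (visser A) (visser B)
  | Imp A B => MBox (MImp (visser A) (visser B))
  end.

Fixpoint msubst (s : nat -> mform) (A : mform) : mform :=
  match A with
  | MVar p => s p
  | MBot => MBot
  | MAnd A B => MAnd (msubst s A) (msubst s B)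
  | MOr A B => MOr (msubst s A) (msubst s B)
  | MImp A B => MImp (msubst s A) (msubst s B)
  | MBox A => MBox (msubst s A)
  end.

(* Boxed formulas are treated as atoms, so that [tautology] singles out the
   substitution instances of the classical propositional tautologies. *)
Fixpoint mtruth (v : nat -> bool) (b : mform -> bool) (A : mform) : bool :=
  match A with
  | MVar p => v p
  | MBot => false
  | MAnd A B => mtruth v b A && mtruth v b B
  | MOr A B => mtruth v b A || mtruth v b B
  | MImp A B => mtruth v b A ==> mtruth v b B
  | MBox A => b A
  end.

Definition tautology (A : mform) : Prop := forall v b, mtruth v b A.

Definition mp_closed (L : set mform) : Prop :=
  forall A B, L (MImp A B) -> L A -> L B.

Record normal_logic (L : set mform) : Prop := NormalLogic {
  normal_taut : forall A, tautology A -> L A;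
  normal_K : forall A B,
    L (MImp (MBox (MImp A B)) (MImp (MBox A) (MBox B)));
  normal_mp : mp_closed L;
  normal_nec : forall A, L A -> L (MBox A);
  normal_subst : forall s A, L A -> L (msubst s A)
}.

Definition GL : set mform :=
  smallest normal_logic
    [set MImp (MBox (MImp (MBox A) A)) (MBox A) | A in [set: mform]].

Definition logicD : set mform :=
  smallest mp_closed
    (GL
     `|` [set F | exists A B,
            F = MImp (MBox (MOr (MBox A) (MBox B))) (MOr (MBox A) (MBox B))]
     `|` [set MNot (MBox MBot)]).

Inductive level : Type := Lv1 | Lv2 | Lv3.

Definition bit (i j : nat) : bool := odd (i %/ 2 ^ j).

(* [GDPL l G D]: the sequent G =>^l D is derivable. The sets are arbitrary, but
   every derivable sequent is finite. *)
Inductive GDPL : level -> set form -> set form -> Prop :=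
| GDPL_var l p : GDPL l [set Var p] [set Var p]
| GDPL_bot l : GDPL l [set Bot] set0
| GDPL_weakL l G D A : GDPL l G D -> GDPL l (A |` G) D
| GDPL_weakR l G D A : GDPL l G D -> GDPL l G (D `|` [set A])
| GDPL_andL l G D A B :
    GDPL l (A |` (B |` G)) D -> GDPL l (And A B |` G) D
| GDPL_andR l G D A B :
    GDPL l G (D `|` [set A]) -> GDPL l G (D `|` [set B]) ->
    GDPL l G (D `|` [set And A B])
| GDPL_orL l G D A B :
    GDPL l (A |` G) D -> GDPL l (B |` G) D -> GDPL l (Or A B |` G) D
| GDPL_orR l G D A B :
    GDPL l G (D `|` [set A] `|` [set B]) -> GDPL l G (D `|` [set Or A B])
| GDPL_lift12 G D : GDPL Lv1 G D -> GDPL Lv2 G D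
| GDPL_impL2 G D A B :
    GDPL Lv2 G (D `|` [set A]) -> GDPL Lv2 (B |` G) D ->
    GDPL Lv2 (Imp A B |` G) D
| GDPL_impR1 (k : nat) (C D : 'I_k -> form) (S : set form) (A B : form) :
    (forall i : nat, i < 2 ^ k ->
       GDPL Lv1
         ([set D j | j in [set j : 'I_k | bit i j]]
            `|` S `|` [set Imp A B] `|` [set A])
         (B |` [set C j | j in [set j : 'I_k | ~~ bit i j]])) ->
    GDPL Lv1 (S `|` [set Imp (C j) (D j) | j in [set: 'I_k]]) [set Imp A B]
| GDPL_lift23 (n m : nat) (A B : 'I_n -> form) (C D : 'I_m -> form)
    (Phi : set nat) :
    GDPL Lv2
      ([set Imp (A i) (B i) | i in [set: 'I_n]] `|` [set Var p | p in Phi])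
      [set Imp (C j) (D j) | j in [set: 'I_m]] ->
    GDPL Lv3
      ([set Imp (A i) (B i) | i in [set: 'I_n]] `|` [set Var p | p in Phi])
      [set Imp (C j) (D j) | j in [set: 'I_m]].

Definition DPL : set form := [set A | GDPL Lv3 set0 [set A]].

(* Main.v *)
From HB Require Import structures.
From mathcomp Require Import all_boot.
From mathcomp Require Import boolp classical_sets cardinality.
Require Import Defs.

Set Implicit Arguments.
Unset Strict Implicit.
Unset Printing Implicit Defensive.

Local Open Scope classical_set_scope.

(** Both directions compare the calculus with classical semantics of modal
    logic.

    From DPL to D, the semantics consists of maximal consistent sets, called
    worlds.  A sequent of level 1 is sound, under Visser's translation, in
    every world containing GL; at level 2 the worlds also satisfy the
    reflection schema [[]A -> A], which is what the left rule for implications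
    asks for; at level 3 they contain D.  The rule for implications on the
    right is a Löb argument ([loeb_succ]): if [[](A -> B)] is refuted, it is
    refuted at a successor where it holds itself, and the truth values of the
    [D_j] there select the premise to contradict.  The lift from level 2 to
    level 3 rests on [reflexive_world]: for every world of D there is a world
    of GL with reflection that contains the same boxed formulas, so boxed
    premises and boxed conclusions cannot distinguish the two.  A formula that
    lies in all worlds of D is a theorem of D, by Lindenbaum's lemma.

    From D to DPL, an underivable formula gets a Kripke countermodel made of
    maximal underivable sequents of subformulas ([saturation]).  Such sequents
    obey the truth clauses for conjunction and disjunction; at level 1, an
    implication of the succedent is refuted at a later sequent with more
    formulas in its antecedent ([imp_counterexample]), so the frame is
    conversely well-founded.  An underivable sequent of level 3 hands its
    variables and implications down to a sequent of level 2, which in turn is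
    underivable at level 1.  The model has the level 3 sequent at its root,
    then infinitely many copies of the level 2 sequent, ordered as a
    descending sequence, and the level 1 sequents on top.  The copies make the
    successors of the root downward directed, so D holds at the root
    ([root_D]), while the translated formula fails there ([root_truth]). *)

(** * Maximal consistent sets of modal formulas *)

Inductive ded (H : set mform) : set mform :=
| ded_hyp A : H A -> ded H A
| ded_mp A B : ded H (MImp A B) -> ded H A -> ded H B.

Lemma ded_monotone H K : H `<=` K -> ded H `<=` ded K.
Proof.
by move=> HK A; elim=> [B /HK|B C _ + _]; [exact: ded_hyp|exact: ded_mp].
Qed.

Lemma deduction H A B : tautology `<=` H ->
  ded (H `|` [set A]) B -> ded H (MImp A B).
Proof.
move=> tH; elim=> [C [HC|->]|C D _ IHCD _ IHC].
- apply: (ded_mp (A := C)); last exact: ded_hyp.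
  by apply/ded_hyp/tH => v b /=; do 2!case: mtruth.
- by apply/ded_hyp/tH => v b /=; case: mtruth.
- apply: (ded_mp (A := MImp A C)) => //.
  apply: (ded_mp (A := MImp A (MImp C D))) => //.
  by apply/ded_hyp/tH => v b /=; do 3!case: mtruth.
Qed.

(** Derivations are finite, so a derivation from the union of a chain already
    lives in one of its members, or in [H] when the chain is empty. *)
Lemma ded_chain H (F : set (set mform)) A : total_on F subset ->
  ded (H `|` \bigcup_(X in F) X) A ->
  ded H A \/ exists2 X, F X & ded (H `|` X) A.
Proof.
move=> totF.
elim=> [B [HB|[X FX XB]]|B C _ IHBC _ IHB].
- by left; exact: ded_hyp.
- by right; exists X => //; apply: ded_hyp; right.
- have up X : ded H `<=` ded (H `|` X) by apply: ded_monotone; exact: subsetUl.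
  have widen X Y : X `<=` Y -> ded (H `|` X) `<=` ded (H `|` Y).
    by move=> XY; apply: ded_monotone; exact: setUS.
  case: IHBC => [dBC|[X FX dBC]]; case: IHB => [dB|[Y FY dB]].
  + by left; exact: ded_mp dBC dB.
  + by right; exists Y => //; exact: ded_mp (up _ _ dBC) dB.
  + by right; exists X => //; exact: ded_mp dBC (up _ _ dB).
  + right; have [XY|YX] := totF X Y FX FY.
      by exists Y => //; exact: ded_mp (widen _ _ XY _ dBC) dB.
    by exists X => //; exact: ded_mp dBC (widen _ _ YX _ dB).
Qed.

Record world (w : set mform) : Prop := World {
  world_taut : tautology `<=` w;
  world_mp : mp_closed w;
  world_bot : ~ w MBot;
  world_not : forall A, ~ w A -> w (MNot A)
}.

Lemma lindenbaum H B : tautology `<=` H -> ~ ded H B ->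
  exists w, [/\ world w, H `<=` w & ~ w B].
Proof.
move=> tH nHB.
have [|X [nXB maxX]] := @Zorn_bigcup _ [set X | ~ ded (H `|` X) B].
  move=> F FP totF /(ded_chain totF)[//|[X FX]].
  exact: FP.
have XP A : ~ X A -> ded (H `|` X) (MImp A B).
  move=> nXA; apply: deduction; first by move=> C /tH; left.
  apply: contrapT => nd; apply: (maxX (X `|` [set A])).
    by split=> [C XC|/(_ A)]; [left|move=> h; apply/nXA/h; right].
  by rewrite /= setUA.
have dedX : ded (H `|` X) `<=` X.
  by move=> A dA; apply: contrapT => /XP nA; exact: nXB (ded_mp nA dA).
have HX : H `<=` X by move=> A HA; apply/dedX/ded_hyp; left.
have nB : ~ X B by move=> XB; apply/nXB/ded_hyp; right.
exists X; split=> //; split.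
- by move=> A /tH /HX.
- move=> A C XAC XA; apply: dedX.
  by apply: (ded_mp (A := A)); apply: ded_hyp; right.
- move=> Xbot; apply: nB; apply/dedX/(ded_mp (A := MBot)); apply: ded_hyp.
    by left; apply: tH => v b.
  by right.
- move=> A nXA; apply: contrapT => nXnA; apply: nXB.
  apply: ded_mp (XP _ nXA); apply: (ded_mp (A := MImp (MNot A) B)).
    by apply: ded_hyp; left; apply: tH => v b /=; do 2!case: mtruth.
  exact: XP.
Qed.

Lemma worldN w A : world w -> w (MNot A) <-> ~ w A.
Proof.
move=> ww; split; last exact: world_not.
by move=> wN wA; apply: (world_bot ww); exact: world_mp wN wA.
Qed.

Lemma worldI w A B : world w -> w (MAnd A B) <-> w A /\ w B.
Proof.
move=> ww; split=> [wAB|[wA wB]].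
  split; apply: (world_mp ww) wAB; apply: world_taut => // v b /=;
  by do 2!case: mtruth.
apply: (world_mp ww) wB; apply: (world_mp ww) wA.
by apply: world_taut => // v b /=; do 2!case: mtruth.
Qed.

Lemma worldImp w A B : world w -> w (MImp A B) <-> (w A -> w B).
Proof.
move=> ww; split=> [|wAB]; first exact: world_mp.
have [wA|/(world_not ww)] := pselect (w A).
  apply: (world_mp ww) (wAB wA); apply: world_taut => // v b /=;
  by do 2!case: mtruth.
apply: (world_mp ww); apply: world_taut => // v b /=;
by do 2!case: mtruth.
Qed.

Lemma worldU w A B : world w -> w (MOr A B) <-> w A \/ w B.
Proof.
move=> ww; split=> [wAB|].
  have [wA|/(world_not ww) wA] := pselect (w A); [by left|right].
  apply: (world_mp ww) wA; apply: (world_mp ww) wAB.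
  by apply: world_taut => // v b /=; do 2!case: mtruth.
by case; apply: (world_mp ww); apply: world_taut => // v b /=;
  do 2!case: mtruth.
Qed.

(** * The canonical worlds of GL *)

Lemma GL_normal : normal_logic GL.
Proof.
split.
- by move=> A tA M hM; apply: (normal_taut hM.1).
- by move=> A B M hM; apply: (normal_K hM.1).
- move=> A B GAB GA M hM; apply: (normal_mp hM.1); [exact: GAB|exact: GA].
- by move=> A GA M hM; apply: (normal_nec hM.1); exact: GA.
- by move=> s A GA M hM; apply: (normal_subst hM.1); exact: GA.
Qed.

Lemma GL_taut : tautology `<=` GL.
Proof. exact: normal_taut GL_normal. Qed.

Lemma GL_loeb A : GL (MImp (MBox (MImp (MBox A) A)) (MBox A)).
Proof. by apply: sub_gen_smallest; exists A. Qed.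

Definition GL_world (w : set mform) : Prop := world w /\ GL `<=` w.

Definition accessible (w v : set mform) : Prop := forall A, w (MBox A) -> v A.

Lemma box_ded w H A : GL_world w -> H `<=` [set B | w (MBox B)] ->
  ded (GL `|` H) A -> w (MBox A).
Proof.
move=> [ww Gw] Hw; elim=> [B [GB|/Hw//]|B C _ IHBC _ IHB].
  by apply: Gw; exact: (normal_nec GL_normal).
apply: (world_mp ww) IHB; apply: (world_mp ww) IHBC.
apply: Gw; exact: (normal_K GL_normal).
Qed.

Lemma box_succ w A : GL_world w ->
  (forall v, GL_world v -> accessible w v -> v A) -> w (MBox A).
Proof.
move=> Gw succA; apply: contrapT => nwA.
have [||v [wv Hv nvA]] := @lindenbaum (GL `|` [set B | w (MBox B)]) A.
- by move=> B /GL_taut; left.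
- by move=> d; apply/nwA/(box_ded Gw _ d).
- apply/nvA/(succA v); first by split=> // B GB; apply: Hv; left.
  by move=> B wB; apply: Hv; right.
Qed.

(** The contrapositive of Löb's axiom: a refuted box is refuted at a successor
    where that box holds, the canonical analogue of a topmost counterexample. *)
Lemma loeb_succ w A : GL_world w -> ~ w (MBox A) ->
  exists v, [/\ GL_world v, accessible w v, v (MBox A) & ~ v A].
Proof.
move=> Gw nwA; apply: contrapT => nv; apply: nwA.
apply: (world_mp Gw.1); first by apply: Gw.2; exact: GL_loeb.
apply: box_succ => // v Gv wv; apply/(worldImp _ _ Gv.1) => vA.
by apply: contrapT => nvA; apply: nv; exists v.
Qed.

(** Transitivity follows from the choice of a successor for the box of
    [A /\ []A]: there [[]A] holds, and so does [A]. *)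
Lemma box4 w A : GL_world w -> w (MBox A) -> w (MBox (MBox A)).
Proof.
move=> Gw wA; have [wAA|] := pselect (w (MBox (MAnd A (MBox A)))).
  apply: box_succ => // v Gv wv.
  by have /(worldI _ _ Gv.1)[] := wv _ wAA.
move=> /(loeb_succ Gw)[v [Gv wv vAA []]]; apply/(worldI _ _ Gv.1).
split; first exact: wv.
apply: box_succ => // u Gu vu.
by have /(worldI _ _ Gu.1)[] := vu _ vAA.
Qed.

Lemma visser_persistent w v A : GL_world w -> GL_world v -> accessible w v ->
  w (visser A) -> v (visser A).
Proof.
move=> Gw Gv wv; elim: A => [p| |A IHA B IHB|A IHA B IHB|A IHA B IHB] /=.
- move=> /(worldI _ _ Gw.1)[_ wp]; apply/(worldI _ _ Gv.1).
  by split; apply: wv => //; exact: box4.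
- by move=> /(world_bot Gw.1).
- by move=> /(worldI _ _ Gw.1)[/IHA vA /IHB vB]; apply/(worldI _ _ Gv.1).
- by move=> /(worldU _ _ Gw.1) H; apply/(worldU _ _ Gv.1); case: H; auto.
- by move=> /(box4 Gw); exact: wv.
Qed.

(** * Soundness of the calculus *)

Lemma binary_digits k (b : nat -> bool) :
  exists2 i, i < 2 ^ k & forall j, j < k -> bit i j = b j.
Proof.
elim: k b => [|k IH] b; first by exists 0.
have [i ik ib] := IH (fun j => b j.+1).
exists (b 0 + i.*2) => [|[|j] jk].
- by rewrite expnS mul2n; case: (b 0); rewrite ?ltn_Sdouble ?ltn_double.
- by rewrite /bit divn1 oddD odd_double addbF oddb.
- by rewrite /bit expnS divnMA divn2 half_bit_double; exact: ib.
Qed.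


Definition D_world (w : set mform) : Prop := world w /\ logicD `<=` w.

Definition admissible (l : level) (w : set mform) : Prop :=
  match l with
  | Lv1 => GL_world w
  | Lv2 => GL_world w /\ forall A, w (MBox A) -> w A
  | Lv3 => D_world w
  end.

Lemma D_world_GL w : D_world w -> GL_world w.
Proof.
case=> ww Dw; split=> // A GA; apply: Dw.
by apply: sub_gen_smallest; left; left.
Qed.

Lemma admissible_world l w : admissible l w -> world w.
Proof. by case: l => [[]|[[]]|[]]. Qed.

Lemma D_world_reflect w A B : D_world w ->
  w (MBox (MOr (MBox A) (MBox B))) -> w (MBox A) \/ w (MBox B).
Proof.
move=> [ww Dw] h; apply/(worldU _ _ ww); apply: (world_mp ww) h.
by apply: Dw; apply: sub_gen_smallest; left; right; exists A, B.
Qed.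

(** The heart of the third level: D proves reflection only for disjunctions of
    boxes, yet the boxes true at a world of D are exactly those true at some
    world satisfying full reflection.  If the required theory
    [{B | []B in w} + {~ []F | []F not in w}] were inconsistent, then [w]
    would contain the box of a disjunction of boxes it refutes.  A finite
    disjunction of refuted boxes is replaced by a single refuted box. *)
Lemma reflexive_world w : D_world w ->
  exists v, admissible Lv2 v /\ forall A, v (MBox A) <-> w (MBox A).
Proof.
move=> Dw; have Gw := D_world_GL Dw; have ww := Gw.1.
pose H := [set B | w (MBox B)] `|`
  [set F | exists2 C, ~ w (MBox C) & F = MNot (MBox C)].
have dedH B : ded (GL `|` H) B ->
    exists2 F, ~ w (MBox F) & w (MBox (MOr B (MBox F))).
  have nbot : ~ w (MBox MBot).
    apply/(worldN _ ww).
    by apply: Dw.2; apply: sub_gen_smallest; right.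
  elim=> [C [GC|[wC|[F nF ->]]]|C E _ [F1 nF1 h1] _ [F2 nF2 h2]].
  - exists MBot => //; apply: box_succ => // v Gv _.
    by apply/(worldU _ _ Gv.1); left; exact: Gv.2.
  - exists MBot => //; apply: box_succ => // v Gv wv.
    by apply/(worldU _ _ Gv.1); left; exact: wv.
  - exists F => //; apply: box_succ => // v Gv _.
    apply/(worldU _ _ Gv.1).
    by have [|/(world_not Gv.1)] := pselect (v (MBox F)); [right|left].
  - exists (MOr (MBox F1) (MBox F2)); first by case/(D_world_reflect Dw).
    apply: box_succ => // v Gv wv; apply/(worldU _ _ Gv.1).
    have up F : v (MBox F) -> F = F1 \/ F = F2 ->
        v (MBox (MOr (MBox F1) (MBox F2))).
      move=> /(box4 Gv) vF F12; apply: box_succ => // u Gu vu.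
      apply/(worldU _ _ Gu.1).
      by case: F12 => <-; [left|right]; exact: vu.
    have /(worldU _ _ Gv.1)[vCE|/up] := wv _ h1; last by right; auto.
    have /(worldU _ _ Gv.1)[vC|/up] := wv _ h2; last by right; auto.
    by left; exact: (world_mp Gv.1) vCE vC.
have [||v [wv Hv _]] := @lindenbaum (GL `|` H) MBot.
- by move=> B /GL_taut; left.
- move=> /dedH[F nF wF]; suff : w (MBox F) \/ w (MBox F) by case.
  apply: (D_world_reflect Dw); apply: box_succ => // v Gv /(_ _ wF).
  move=> /(worldU _ _ Gv.1)[/(world_bot Gv.1)//|vF].
  by apply/(worldU _ _ Gv.1); left.
have Gv : GL_world v by split=> // B GB; apply: Hv; left.
have eqbox B : v (MBox B) <-> w (MBox B).
  split=> [vB|wB]; last by apply: Hv; right; left; exact: box4.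
  apply: contrapT => nwB; apply/(worldN _ wv) : vB.
  by apply: Hv; right; right; exists B.
by exists v; split=> //; split=> // B /eqbox wB; apply: Hv; right; left.
Qed.

Lemma GDPL_sound l G D : GDPL l G D -> forall w, admissible l w ->
  (forall A, G A -> w (visser A)) -> exists2 A, D A & w (visser A).
Proof.
elim=> {l G D}.
- by move=> l p w _ h; exists (Var p) => //; exact: h.
- move=> l w /admissible_world ww h.
  by have /(world_bot ww) := h Bot erefl.
- by move=> l G D A _ IH w aw h; apply: IH => // B GB; apply: h; right.
- move=> l G D A _ IH w aw h; have [B DB wB] := IH w aw h.
  by exists B => //; left.
- move=> l G D A B _ IH w aw h; apply: IH => // E.
  have /= /(worldI _ _ (admissible_world aw))[wA wB] :=
    h (And A B) (or_introl erefl).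
  by move=> [->|[->|GE]] //; apply: h; right.
- move=> l G D A B _ IHA _ IHB w aw h.
  have [E [DE|->] wE] := IHA w aw h; first by exists E => //; left.
  have [F [DF|->] wF] := IHB w aw h; first by exists F => //; left.
  exists (And A B); first by right.
  by apply/(worldI _ _ (admissible_world aw)).
- move=> l G D A B _ IHA _ IHB w aw h.
  have /= /(worldU _ _ (admissible_world aw))[wA|wB] :=
    h (Or A B) (or_introl erefl).
  + by apply: IHA => // E [->|GE] //; apply: h; right.
  + by apply: IHB => // E [->|GE] //; apply: h; right.
- move=> l G D A B _ IH w aw h.
  have ww := admissible_world aw.
  have [E [[DE|->]|->] wE] := IH w aw h; first by exists E => //; left.
  + by exists (Or A B); [right|apply/(worldU _ _ ww); left].
  + by exists (Or A B); [right|apply/(worldU _ _ ww); right].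
- by move=> G D _ IH w [Gw _] h; exact: IH.
- move=> G D A B _ IHA _ IHB w aw h.
  have [E [DE|->] wE] := IHA w aw (fun E GE => h E (or_intror GE)).
    by exists E.
  apply: IHB => // F [->|GF]; last by apply: h; right.
  apply: (world_mp (admissible_world aw)) wE; apply: aw.2.
  exact: (h (Imp A B) (or_introl erefl)).
- move=> k C D S A B _ IH w Gw h.
  exists (Imp A B) => //=; apply: contrapT => /(loeb_succ Gw)[v [Gv wv vAB]].
  rewrite (worldImp _ _ Gv.1) => /not_implyP[vA nvB].
  (* The premise to use is read off from the consequents true at [v]. *)
  have [i ik bitP] := binary_digits k (fun j =>
    if insub j is Some j' then `[< v (visser (D j')) >] else false).
  have {}bitP (j : 'I_k) : bit i j <-> v (visser (D j)).
    by rewrite bitP // valK; split=> /asboolP.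
  have [E [[[[j /bitP vD <-]|SE]|->]|->]|E [->|[j /negP jb <-]] vE] // :=
    IH i ik v Gv.
  + apply: (visser_persistent Gw Gv wv); by apply: h; left.
  + apply/jb/bitP; apply: (world_mp Gv.1) vE; apply: wv.
    by apply: (h (Imp (C j) (D j))); right; exists j.
- move=> n m A B C D Phi _ IH w Dw h.
  have [v [av eqvw]] := reflexive_world Dw.
  have [E [[i _ <-]|[p Phip <-]]|E [j _ <-] vE] // := IH v av.
  + by apply/eqvw; apply: (h (Imp (A i) (B i))); left; exists i.
  + have /= /(worldI _ _ Dw.1)[_ /eqvw vp] : w (visser (Var p)).
      by apply: h; right; exists p.
    by apply/(worldI _ _ av.1.1); split=> //; exact: av.2.
  + by exists (Imp (C j) (D j)); [exists j|apply/eqvw].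
Qed.

Lemma DPL_sound A : DPL A -> logicD (visser A).
Proof.
move=> dA; apply: contrapT => nA.
have D_mp : mp_closed logicD.
  move=> B C DBC DB M hM; apply: hM.1; [exact: DBC|exact: DB].
have GLD : GL `<=` logicD by move=> B GB; apply: sub_gen_smallest; left; left.
have [||w [ww Dw nw]] := @lindenbaum logicD (visser A).
- by move=> B /GL_taut /GLD.
- by move=> d; apply: nA; elim: d => // B C _ + _; exact: D_mp.
- by have [|_ ->] := GDPL_sound dA (conj ww Dw).
Qed.

(** * Kripke models *)

Section Kripke.
Variables (T : Type) (R : T -> T -> Prop).

Fixpoint forces (V : T -> nat -> bool) (x : T) (A : mform) : bool :=
  match A with
  | MVar p => V x p
  | MBot => false
  | MAnd A B => forces V x A && forces V x B
  | MOr A B => forces V x A || forces V x B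
  | MImp A B => forces V x A ==> forces V x B
  | MBox A => `[< forall y, R x y -> forces V y A >]
  end.

Lemma forces_mtruth V x A :
  mtruth (V x) (fun B => forces V x (MBox B)) A = forces V x A.
Proof. by elim: A => //= A -> B ->. Qed.

Lemma forces_subst V s x A :
  forces V x (msubst s A) = forces (fun y p => forces V y (s p)) x A.
Proof.
elim: A x => //= [A IHA B IHB x|A IHA B IHB x|A IHA B IHB x|A IHA x];
  rewrite ?IHA ?IHB //.
by congr asbool; apply/propext; split=> h y Rxy; [rewrite -IHA|rewrite IHA];
  exact: h.
Qed.

Hypothesis Rtrans : forall x y z, R x y -> R y z -> R x z.
Hypothesis Rwf : well_founded (fun y x => R x y).

Lemma GL_forces V x A : GL A -> forces V x A.
Proof.
move=> GA; pose L := [set B | forall V x, forces V x B].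
suff: L A by exact.
apply: GA; split; first split.
- by move=> B tB W y; rewrite -forces_mtruth; exact: tB.
- move=> B C W y /=; apply/implyP => /asboolP hBC; apply/implyP => /asboolP hB.
  by apply/asboolP => z Ryz; exact: implyP (hBC z Ryz) (hB z Ryz).
- by move=> B C hBC hB W y; exact: implyP (hBC W y) (hB W y).
- by move=> B hB W y /=; apply/asboolP => z _; exact: hB.
- by move=> s B hB W y; rewrite forces_subst; exact: hB.
- move=> _ [B _ <-] W y /=; apply/implyP => /asboolP h; apply/asboolP => z.
  elim/(well_founded_ind Rwf): z => z IHz Ryz.
  apply: implyP (h z Ryz) _; apply/asboolP => u Rzu.
  exact: IHz (Rtrans Ryz Rzu).
Qed.

(** The downward directedness of the successors of [r] is what validates the
    disjunction axiom at [r]: a common predecessor of a successor refuting [A]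
    and one refuting [B] is itself a successor of [r], and refutes
    [[]A \/ []B].  The property is asked of [r] alone because the axioms of D
    are not necessitated. *)
Lemma D_forces V r A : (exists y, R r y) ->
  (forall y z, R r y -> R r z -> exists2 u, R r u & R u y /\ R u z) ->
  logicD A -> forces V r A.
Proof.
move=> [y0 Ry0] Rdir DA; apply: (DA [set B | forces V r B]); split.
  by move=> B C; exact: implyP.
move=> _ [[/(GL_forces V r)//|[B [C ->]]]|->] /=; last first.
  by apply/implyP => /asboolP/(_ y0 Ry0).
apply/implyP => /asboolP h; apply: contrapT => /negP; rewrite negb_or.
move=> /andP[/asboolPn/existsNP[y /not_implyP[Ry nB]]].
move=> /asboolPn/existsNP[z /not_implyP[Rz nC]].
have [u Ru [Ruy Ruz]] := Rdir y z Ry Rz.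
by case/orP: (h u Ru) => /asboolP; [move=> /(_ y Ruy)|move=> /(_ z Ruz)].
Qed.

End Kripke.

(** * Weakening and identity in the calculus *)

HB.instance Definition _ := gen_eqMixin form.

Lemma set_cons (T : eqType) (x : T) s : [set` x :: s] = x |` [set` s].
Proof.
apply/seteqP; split=> y /=; rewrite inE; first by case/predU1P; [left|right].
by case=> [->|->]; rewrite ?eqxx ?orbT.
Qed.

Lemma GDPL_weakening l G G' D D' : finite_set G' -> finite_set D' ->
  G `<=` G' -> D `<=` D' -> GDPL l G D -> GDPL l G' D'.
Proof.
move=> /finite_seqP[s sE] /finite_seqP[t tE] GG' DD' d.
have {}sE : G' = [set` s] `|` G by rewrite -sE; apply/esym/setUidl.
have {}tE : D' = D `|` [set` t] by rewrite -tE; apply/esym/setUidr.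
rewrite {}sE {}tE {GG' DD'}; elim: s => [|B s IHs].
  rewrite set_nil set0U; elim: t => [|B t IHt]; first by rewrite set_nil setU0.
  rewrite (_ : _ `|` _ = (D `|` [set` t]) `|` [set B]); first exact: GDPL_weakR.
  by rewrite -setUA; congr setU; rewrite setUC; exact: set_cons.
rewrite (_ : _ `|` _ = B |` ([set` s] `|` G)); first exact: GDPL_weakL.
by rewrite setUA; congr setU; exact: set_cons.
Qed.

Lemma finite_adj T (A : T) G : finite_set G -> finite_set (A |` G).
Proof. by move=> fG; rewrite finite_setU; split=> //; exact: finite_set1. Qed.

(** The rule for implications on the right is applied with the implication
    [A -> B] itself as its only side formula [C -> D]. *)
Lemma GDPL_identity l A G D : l <> Lv3 -> finite_set G -> finite_set D ->
  G A -> D A -> GDPL l G D.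
Proof.
move=> nl3 fG fD GA DA; apply: (@GDPL_weakening l [set A] _ [set A]) => //.
- by move=> _ ->.
- by move=> _ ->.
move=> {G D fG fD GA DA}.
suff d : GDPL Lv1 [set A] [set A] by case: l nl3 => // _; exact: GDPL_lift12.
elim: A {l nl3} => [p| |A IHA B IHB|A IHA B IHB|A IHA B IHB].
- exact: GDPL_var.
- by rewrite -{2}[ [set _] ]set0U; apply/GDPL_weakR/GDPL_bot.
- rewrite -{1}(setU0 [set And A B]) -[in X in GDPL _ _ X](set0U [set And A B]).
  apply: GDPL_andL; apply: GDPL_andR; rewrite set0U setU0.
    by rewrite setUC; exact: GDPL_weakL.
  exact: GDPL_weakL.
- rewrite -{1}(setU0 [set Or A B]) -[in X in GDPL _ _ X](set0U [set Or A B]).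
  apply: GDPL_orR; apply: GDPL_orL; rewrite set0U setU0.
    exact: GDPL_weakR.
  by rewrite setUC; exact: GDPL_weakR.
- have -> : [set Imp A B] =
      set0 `|` [set Imp ((fun=> A) j) ((fun=> B) j) | j in [set: 'I_1]].
    by rewrite set0U; apply/seteqP; split=> [_ ->|_ [j _ <-]] //; exists ord0.
  have fin (P : set 'I_1) E : finite_set [set E | j in P].
    exact/finite_image/finite_finset.
  rewrite [X in GDPL _ _ X](_ : _ = [set Imp A B]); last first.
    by rewrite set0U; apply/seteqP; split=> [_ [j _ <-]|_ ->] //; exists ord0.
  apply: GDPL_impR1 => i _; rewrite setU0.
  case bi: (bit i (ord0 : 'I_1)).
    apply: GDPL_weakening IHB.
    + by rewrite !finite_setU; do !split=> //; exact: finite_set1.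
    + exact: finite_adj.
    + by move=> _ ->; left; left; exists ord0.
    + by move=> _ ->; left.
  apply: GDPL_weakening IHA.
  + by rewrite !finite_setU; do !split=> //; exact: finite_set1.
  + exact: finite_adj.
  + by move=> _ ->; right.
  + by move=> _ ->; right; exists ord0 => //=; rewrite bi.
Qed.

(** * Maximal underivable sequents *)

Fixpoint subformulas (A : form) : seq form :=
  A :: match A with
       | Var _ | Bot => [::]
       | And B C | Or B C | Imp B C => subformulas B ++ subformulas C
       end.

Definition subformula_closed (cl : seq form) : Prop :=
  forall A, A \in cl -> {subset subformulas A <= cl}.

Lemma subformulas_closed A : subformula_closed (subformulas A).
Proof.
elim: A => [p| |A IHA B IHB|A IHA B IHB|A IHA B IHB] E;
  rewrite in_cons => /predU1P[->//|] //;
  rewrite mem_cat => /orP[/IHA|/IHB] sub F /sub FE;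
  by rewrite inE mem_cat FE ?orbT.
Qed.

Lemma closed_children cl B C E : subformula_closed cl -> E \in cl ->
  E = And B C \/ E = Or B C \/ E = Imp B C -> B \in cl /\ C \in cl.
Proof.
move=> clP /clP sub EE.
have self F : F \in subformulas F by case: F => *; rewrite inE eqxx.
by case: EE => [|[]] EE; move: sub; rewrite EE => sub; split; apply: sub;
  rewrite inE mem_cat self ?orbT.
Qed.

Definition missing (cl : seq form) (G : set form) : nat :=
  count (fun B => `[< ~ G B >]) cl.

Lemma missing_lt cl G G' B : G `<=` G' -> B \in cl -> ~ G B -> G' B ->
  missing cl G' < missing cl G.
Proof.
move=> GG' Bcl nGB GB.
have le s : missing s G' <= missing s G.
  by apply: sub_count => E /asboolP nG'; apply/asboolP => /GG'.
case/splitPr: Bcl => s t; rewrite /missing !count_cat /= asboolF; last first.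
  by apply; exact: GB.
by rewrite asboolT // add0n add1n addnS ltnS leq_add // le.
Qed.

Record saturated (l : level) (cl : seq form) (G D : set form) : Prop :=
  Saturated {
    sat_ante : G `<=` [set` cl];
    sat_succ : D `<=` [set` cl];
    sat_underivable : ~ GDPL l G D;
    sat_maxL : forall B, B \in cl -> ~ GDPL l (B |` G) D -> G B;
    sat_maxR : forall B, B \in cl -> ~ GDPL l G (D `|` [set B]) -> D B
  }.

Lemma saturation l cl G D : G `<=` [set` cl] -> D `<=` [set` cl] ->
  ~ GDPL l G D ->
  exists G' D', [/\ G `<=` G', D `<=` D' & saturated l cl G' D'].
Proof.
have [n] := ubnP (missing cl G + missing cl D).
elim: n => // n IHn in G D *; rewrite ltnS => mn Gcl Dcl nd.
have [[B [Bcl nGB ndB]]|noL] := pselect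
    (exists B, [/\ B \in cl, ~ G B & ~ GDPL l (B |` G) D]).
  have [||//|//|G' [D' [GG' DD' sat]]] := IHn (B |` G) D.
  - apply: leq_trans mn; rewrite ltn_add2r.
    by apply: (missing_lt _ Bcl nGB); [exact: subsetUr|left].
  - by move=> E [->|/Gcl].
  - by exists G', D'; split=> // E GE; apply: GG'; right.
have [[B [Bcl nDB ndB]]|noR] := pselect
    (exists B, [/\ B \in cl, ~ D B & ~ GDPL l G (D `|` [set B])]).
  have [|//||//|G' [D' [GG' DD' sat]]] := IHn G (D `|` [set B]).
  - apply: leq_trans mn; rewrite ltn_add2l.
    by apply: (missing_lt _ Bcl nDB); [exact: subsetUl|right].
  - by move=> E [/Dcl|->].
  - by exists G', D'; split=> // E DE; apply: DD'; left.
exists G, D; split=> //; split=> // B Bcl ndB; apply: contrapT => nB.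
  by apply: noL; exists B.
by apply: noR; exists B.
Qed.

Section SaturatedSequent.
Variables (l : level) (cl : seq form) (G D : set form).
Hypotheses (clP : subformula_closed cl) (sat : saturated l cl G D).

Lemma sat_finL : finite_set G.
Proof. exact: sub_finite_set (sat_ante sat) (finite_seq cl). Qed.

Lemma sat_finR : finite_set D.
Proof. exact: sub_finite_set (sat_succ sat) (finite_seq cl). Qed.

Lemma sat_bot : ~ G Bot.
Proof.
move=> GB; apply: (sat_underivable sat).
apply: GDPL_weakening (GDPL_bot l) => //; first exact: sat_finL.
  exact: sat_finR.
by move=> _ ->.
Qed.

Lemma sat_var p : G (Var p) -> ~ D (Var p).
Proof.
move=> Gp Dp; apply: (sat_underivable sat).
apply: GDPL_weakening (GDPL_var l p); first exact: sat_finL.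
- exact: sat_finR.
- by move=> _ ->.
- by move=> _ ->.
Qed.

Lemma adjL A : G A -> A |` G = G.
Proof. by move=> GA; apply/setUidPr => _ ->. Qed.

Lemma adjR A : D A -> D `|` [set A] = D.
Proof. by move=> DA; apply/setUidPl => _ ->. Qed.

Lemma sat_andL A B : G (And A B) -> G A /\ G B.
Proof.
move=> GAB; have [Acl Bcl] : A \in cl /\ B \in cl.
  by apply: (closed_children clP (sat_ante sat GAB)); auto.
have nd : ~ GDPL l (A |` (B |` G)) D.
  by move=> /GDPL_andL; rewrite adjL //; exact: (sat_underivable sat).
split; apply: (sat_maxL sat) => // d; apply: nd.
  by rewrite setUCA; exact: GDPL_weakL.
exact: GDPL_weakL.
Qed.

Lemma sat_andR A B : D (And A B) -> D A \/ D B.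
Proof.
move=> DAB; have [Acl Bcl] : A \in cl /\ B \in cl.
  by apply: (closed_children clP (sat_succ sat DAB)); auto.
apply: contrapT => /not_orP[nA nB]; apply: (sat_underivable sat).
rewrite -(adjR DAB); apply: GDPL_andR; apply: contrapT.
  by move/(sat_maxR sat Acl).
by move/(sat_maxR sat Bcl).
Qed.

Lemma sat_orL A B : G (Or A B) -> G A \/ G B.
Proof.
move=> GAB; have [Acl Bcl] : A \in cl /\ B \in cl.
  by apply: (closed_children clP (sat_ante sat GAB)); auto.
apply: contrapT => /not_orP[nA nB]; apply: (sat_underivable sat).
rewrite -(adjL GAB); apply: GDPL_orL; apply: contrapT.
  by move/(sat_maxL sat Acl).
by move/(sat_maxL sat Bcl).
Qed.

Lemma sat_orR A B : D (Or A B) -> D A /\ D B.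
Proof.
move=> DAB; have [Acl Bcl] : A \in cl /\ B \in cl.
  by apply: (closed_children clP (sat_succ sat DAB)); auto.
have nd : ~ GDPL l G (D `|` [set A] `|` [set B]).
  by move=> /GDPL_orR; rewrite adjR //; exact: (sat_underivable sat).
split; apply: (sat_maxR sat) => // d; apply: nd.
  exact: GDPL_weakR.
by rewrite setUAC; exact: GDPL_weakR.
Qed.

End SaturatedSequent.

Lemma sat_impL cl G D A B : subformula_closed cl -> saturated Lv2 cl G D ->
  G (Imp A B) -> D A \/ G B.
Proof.
move=> clP sat GAB; have [Acl Bcl] : A \in cl /\ B \in cl.
  by apply: (closed_children clP (sat_ante sat GAB)); auto.
apply: contrapT => /not_orP[nA nB]; apply: (sat_underivable sat).
rewrite -(adjL GAB); apply: GDPL_impL2; apply: contrapT.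
  by move/(sat_maxR sat Acl).
by move/(sat_maxL sat Bcl).
Qed.

Lemma enum_imps G : finite_set G -> exists k (C D : 'I_k -> form),
  [set Imp (C j) (D j) | j in [set: 'I_k]] =
  [set E | G E /\ exists A B, E = Imp A B].
Proof.
move=> fG.
have /finite_seqP[s sE] : finite_set [set ab : form * form | G (Imp ab.1 ab.2)].
  apply: (@finite_preimage _ _ G (fun ab => Imp ab.1 ab.2)) => //.
  by move=> [A B] [A' B'] _ _ /= [-> ->].
have memP A B : (A, B) \in s <-> G (Imp A B).
  by rewrite (_ : (_ \in s) = [set` s] (A, B) :> Prop) // -sE.
exists (size s), (fun j => (tnth (in_tuple s) j).1),
  (fun j => (tnth (in_tuple s) j).2).
apply/seteqP; split=> [_ [j _ <-]|E [GE [A [B AB]]]] /=.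
  split; last by do 2!eexists.
  by apply/memP; rewrite -surjective_pairing; exact: mem_tnth.
move: GE; rewrite AB => /memP/(tnthP (in_tuple s))[j jE].
by exists j => //; rewrite -jE.
Qed.

(** * The countermodel of an underivable formula *)

(** The accessibility of saturated sequents: an implication of the antecedent
    is discharged at the later sequent, and strict growth of the antecedent,
    within a finite set of formulas, makes the relation conversely
    well-founded. *)
Definition step (G G' D' : set form) : Prop :=
  [/\ G `<=` G',
      forall A B, G (Imp A B) -> D' A \/ G' B &
      exists2 E, G' E & ~ G E].

(** The rule for implications on the right read upwards: with all of [G] as
    side formulas [Sigma], some premise is underivable, and its digits say how
    each implication of [G] is discharged. *)
Lemma imp_counterexample cl G D A B : subformula_closed cl ->
  G `<=` [set` cl] -> D `<=` [set` cl] -> ~ GDPL Lv1 G D -> D (Imp A B) ->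
  exists G' D', [/\ saturated Lv1 cl G' D', step G G' D', G' A & D' B].
Proof.
move=> clP Gcl Dcl nd DAB.
have fG : finite_set G by exact: sub_finite_set Gcl (finite_seq cl).
have fD : finite_set D by exact: sub_finite_set Dcl (finite_seq cl).
have nGAB : ~ G (Imp A B).
  by move=> GAB; apply: nd; exact: GDPL_identity GAB DAB.
have [k [C [C' CE]]] := enum_imps fG.
have GC j : G (Imp (C j) (C' j)).
  have : [set Imp (C j) (C' j) | j in [set: 'I_k]] (Imp (C j) (C' j)).
    by exists j.
  by rewrite CE => -[].
have [i ik ndi] : exists2 i, i < 2 ^ k & ~ GDPL Lv1
    ([set C' j | j in [set j : 'I_k | bit i j]] `|` G `|` [set Imp A B]
      `|` [set A])
    (B |` [set C j | j in [set j : 'I_k | ~~ bit i j]]).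
  apply: contrapT => no; apply: nd.
  have d : GDPL Lv1 (G `|` [set Imp (C j) (C' j) | j in [set: 'I_k]])
      [set Imp A B].
    by apply: GDPL_impR1 => i ik; apply: contrapT => ndi; apply: no; exists i.
  apply: GDPL_weakening d => //; last by move=> _ ->.
  by rewrite CE => E [|[]].
have [Acl Bcl] : A \in cl /\ B \in cl.
  by apply: (closed_children clP (Dcl _ DAB)); auto.
have Ccl j : C j \in cl /\ C' j \in cl.
  by apply: (closed_children clP (Gcl _ (GC j))); auto.
have [||G' [D' [GG' DD' sat]]] := @saturation Lv1 cl _ _ _ _ ndi.
- move=> E [[[[j _ <-]|/Gcl]|->]|->] //=; first by case: (Ccl j).
  exact: (Dcl _ DAB).
- by move=> E [->|[j _ <-]] //=; case: (Ccl j).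
exists G', D'; split=> //; last by apply: DD'; left.
- split; first by move=> E GE; apply: GG'; left; left; right.
  + move=> E F GEF.
    have : [set H | G H /\ exists A B, H = Imp A B] (Imp E F).
      by split=> //; exists E, F.
    rewrite -CE => -[j _ [<- <-]]; case bj: (bit i j).
      by right; apply: GG'; left; left; left; exists j.
    by left; apply: DD'; right; exists j => //=; rewrite bj.
  + by exists (Imp A B) => //; apply: GG'; left; right.
- by apply: GG'; right.
Qed.

(** Saturated sequents of level 1 form the finite upper part of the model.
    Below it lies a descending sequence of copies of one saturated sequent of
    level 2, whose implication rule makes that sequent discharge its own
    implications, and at the bottom a root, with the formulas of level 3. *)
Inductive node := Root | Tail (n : nat) | Top (G D : set form).

Section Countermodel.
Variables (cl : seq form) (G2 D2 G3 D3 : set form).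
Hypothesis clP : subformula_closed cl.
Hypothesis sat2 : saturated Lv2 cl G2 D2.
Hypothesis sat3 : saturated Lv3 cl G3 D3.
Hypothesis var32 : forall p, G3 (Var p) -> G2 (Var p).
Hypothesis imp32L : forall A B, G3 (Imp A B) -> G2 (Imp A B).
Hypothesis imp32R : forall A B, D3 (Imp A B) -> D2 (Imp A B).

(** At the root these are the sequent of the tail: that is the one to which
    the implications of level 3 are handed over. *)
Definition antecedent (x : node) : set form := if x is Top G _ then G else G2.
Definition succedent (x : node) : set form := if x is Top _ D then D else D2.

Definition sees (x y : node) : Prop :=
  match y with
  | Root => False
  | Tail m =>
      match x with Root => True | Tail n => m < n | Top _ _ => False end
  | Top G D => saturated Lv1 cl G D /\ step (antecedent x) G D
  end.

Definition valuation (x : node) (p : nat) : bool :=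
  `[< (if x is Root then G3 else antecedent x) (Var p) >].

Definition internal (x : node) : Prop :=
  match x with
  | Root => False
  | Tail _ => True
  | Top G D => saturated Lv1 cl G D
  end.

Notation forced x A := (forces sees valuation x (visser A)).

Lemma sees_internal x y : sees x y -> internal y.
Proof. by case: y => //= G D []. Qed.

Lemma sees_ante x y : sees x y -> antecedent x `<=` antecedent y.
Proof.
by case: y => [|m|G D] //=; [case: x => [|n|G D] // _ A|case=> _ []].
Qed.

Lemma sees_trans x y z : sees x y -> sees y z -> sees x z.
Proof.
case: z => [|m|G D] //= xy.
  case: y xy => [|n|G D] //=; case: x => //= k nk mn; exact: ltn_trans mn nk.
case=> sat [sub dis [E GE nE]]; split=> //; have xsub := sees_ante xy.
split; first exact: subset_trans sub.
  by move=> A B /xsub; exact: dis.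
by exists E => // /xsub.
Qed.

Lemma sees_wf : well_founded (fun y x => sees x y).
Proof.
have accTop G D : Acc (fun y x => sees x y) (Top G D).
  have [n] := ubnP (missing cl G); elim: n G D => [G D|n IHn G D mn].
    by rewrite ltn0.
  constructor=> -[[]|m []|G' D' [sat [sub _ [E GE nE]]]]; apply: IHn.
  rewrite ltnS in mn; apply: leq_trans mn.
  exact: (missing_lt sub (sat_ante sat GE) nE GE).
have accTail n : Acc (fun y x => sees x y) (Tail n).
  elim/ltn_ind: n => n IHn; constructor=> -[[]|m mn|G D _]; first exact: IHn.
  exact: accTop.
case=> [|n|G D]; [|exact: accTail|exact: accTop].
constructor=> -[[]|m _|G D _]; [exact: accTail|exact: accTop].
Qed.

Lemma sees_impL x y A B : sees x y -> antecedent x (Imp A B) ->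
  succedent y A \/ antecedent y B.
Proof.
case: y => [|m|G D] //=; last by case=> _ [_ + _]; apply.
by case: x => [|n|G D] //= _; exact: (sat_impL clP sat2).
Qed.

Lemma impR_sees x A B : x = Root \/ internal x -> succedent x (Imp A B) ->
  exists y, [/\ sees x y, antecedent y A & succedent y B].
Proof.
move=> xi xAB.
have [xcl xcl' nd] : [/\ antecedent x `<=` [set` cl],
    succedent x `<=` [set` cl] & ~ GDPL Lv1 (antecedent x) (succedent x)].
  have sub2 : [/\ G2 `<=` [set` cl], D2 `<=` [set` cl] & ~ GDPL Lv1 G2 D2].
    by case: sat2 => ? ? nd *; split=> // /GDPL_lift12.
  by case: x xi {xAB} => //= G D [//|[]].
have [G [D [sat st GA DB]]] := imp_counterexample clP xcl xcl' nd xAB.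
by exists (Top G D).
Qed.

Lemma internal_saturated x : internal x ->
  exists l, saturated l cl (antecedent x) (succedent x).
Proof. by case: x => //= [n|G D] *; [exists Lv2|exists Lv1]. Qed.

Lemma internal_truth A x : internal x ->
  (antecedent x A -> forced x A) /\ (succedent x A -> ~ forced x A).
Proof.
elim: A x => [p| |A IHA B IHB|A IHA B IHB|A IHA B IHB] x xi;
  have [l sat] := internal_saturated xi => /=.
- have valE y : internal y -> valuation y p = `[< antecedent y (Var p) >].
    by case: y.
  rewrite valE //; split=> [xp|xp /andP[/asboolP /(sat_var sat)]//].
  apply/andP; split; first exact/asboolP.
  apply/asboolP => y xy; rewrite valE; last exact: sees_internal xy.
  exact/asboolP/(sees_ante xy).
- by split=> // /(sat_bot sat).
- have [pA nA] := IHA x xi; have [pB nB] := IHB x xi.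
  split=> [/(sat_andL clP sat)[/pA -> /pB ->]//|].
  by move=> /(sat_andR clP sat)[/nA|/nB] n /andP[].
- have [pA nA] := IHA x xi; have [pB nB] := IHB x xi.
  split=> [/(sat_orL clP sat)[/pA|/pB] ->|]; rewrite ?orbT //.
  by move=> /(sat_orR clP sat)[/nA ? /nB ?] /orP[].
- split=> [xAB|/(impR_sees (or_intror xi))[y [xy yA yB]] /asboolP/(_ y xy)].
    apply/asboolP => y xy; apply/implyP => yA.
    have [_ nA] := IHA y (sees_internal xy).
    have [pB _] := IHB y (sees_internal xy).
    by case: (sees_impL xy xAB) => [/nA|/pB].
  have [pA _] := IHA y (sees_internal xy).
  have [_ nB] := IHB y (sees_internal xy).
  by move=> /implyP/(_ (pA yA))/(nB yB).
Qed.

Lemma root_truth A : (G3 A -> forced Root A) /\ (D3 A -> ~ forced Root A).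
Proof.
elim: A => [p| |A [pA nA] B [pB nB]|A [pA nA] B [pB nB]|A _ B _] /=.
- split=> [Gp|Dp /andP[/asboolP /(sat_var sat3)]//].
  apply/andP; split; first exact/asboolP.
  apply/asboolP => y xy; apply/asboolP.
  have : antecedent y (Var p) by apply: (sees_ante xy); exact: var32.
  by case: y xy.
- by split=> // /(sat_bot sat3).
- split=> [/(sat_andL clP sat3)[/pA -> /pB ->]//|].
  by move=> /(sat_andR clP sat3)[/nA|/nB] n /andP[].
- split=> [/(sat_orL clP sat3)[/pA|/pB] ->|]; rewrite ?orbT //.
  by move=> /(sat_orR clP sat3)[/nA ? /nB ?] /orP[].
- split=> [/imp32L GAB|/imp32R DAB].
    apply/asboolP => y xy; apply/implyP => yA.
    have [_ nA] := internal_truth A (sees_internal xy).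
    have [pB _] := internal_truth B (sees_internal xy).
    by case: (sees_impL xy GAB) => [/nA|/pB].
  have [y [xy yA yB]] := impR_sees (or_introl erefl) DAB.
  have [pA _] := internal_truth A (sees_internal xy).
  have [_ nB] := internal_truth B (sees_internal xy).
  by move=> /asboolP/(_ y xy)/implyP/(_ (pA yA))/(nB yB).
Qed.

(** A tail node far enough down sees any two given successors of the root. *)
Lemma root_D A : logicD A -> forces sees valuation Root A.
Proof.
apply: (D_forces sees_trans sees_wf); first by exists (Tail 0).
have below y : sees Root y -> exists n, forall m, n <= m -> sees (Tail m) y.
  by case: y => //= [k _|G D Gy]; [exists k.+1|exists 0].
move=> y z /below[n yn] /below[m zm]; exists (Tail (maxn n m)) => //.
by split; [apply: yn; exact: leq_maxl|apply: zm; exact: leq_maxr].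
Qed.

End Countermodel.

Lemma DPL_complete A : logicD (visser A) -> DPL A.
Proof.
move=> DA; apply: contrapT => nA; set cl := subformulas A.
have clP : subformula_closed cl by exact: subformulas_closed.
have [||G3 [D3 [_ D3A sat3]]] := @saturation Lv3 cl _ _ _ _ nA.
- by [].
- by move=> _ -> /=; rewrite /cl; case: (A) => *; rewrite inE eqxx.
have [n [E [F EF]]] := enum_imps (sat_finL sat3).
have [m [C [D CD]]] := enum_imps (sat_finR sat3).
pose Phi := [set p | G3 (Var p)].
have nd2 : ~ GDPL Lv2
    ([set Imp (E i) (F i) | i in [set: 'I_n]] `|` [set Var p | p in Phi])
    [set Imp (C j) (D j) | j in [set: 'I_m]].
  move=> /GDPL_lift23 d; apply: (sat_underivable sat3).
  apply: GDPL_weakening d; [exact: (sat_finL sat3)|exact: (sat_finR sat3)| |].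
    by rewrite EF => H [[]|[p Gp <-]].
  by rewrite CD => H [].
have [||G2 [D2 [G32 D32 sat2]]] := @saturation Lv2 cl _ _ _ _ nd2.
- by rewrite EF => H [[/(sat_ante sat3)]|[p /(sat_ante sat3) ? <-]].
- by rewrite CD => H [/(sat_succ sat3)].
have var32 p : G3 (Var p) -> G2 (Var p).
  by move=> Gp; apply: G32; right; exists p.
have imp32L B B' : G3 (Imp B B') -> G2 (Imp B B').
  by move=> GB; apply: G32; left; rewrite EF; split=> //; exists B, B'.
have imp32R B B' : D3 (Imp B B') -> D2 (Imp B B').
  by move=> DB; apply: D32; rewrite CD; split=> //; exists B, B'.
have [_ nf] := root_truth clP sat2 sat3 var32 imp32L imp32R A.
by apply: nf (D3A _ erefl) _; exact: root_D.
Qed.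

Theorem corollary8p11 (A : form) : DPL A <-> logicD (visser A).
Proof. by split; [exact: DPL_sound|exact: DPL_complete]. Qed.
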